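(* Let $d\ge1$, $\rho>0$, and let $K$ be a finite simplicial complex with $K=\mathrm{VR}(V,\rho)$ for some finite vertex set $V\subset\mathbb{R}^d$ (i.e. $K$ has a $d$-dimensional Vietoris–Rips representation with parameter $\rho$). Let $\eta$ be a stationary Poisson point process on $\mathbb{R}^d$ with intensity $t>0$. Then almost surely the infinite Vietoris–Rips complex $\mathrm{VR}(\eta,\rho)$ contains infinitely many isolated simplicial complexes $K_n$, $n\in\mathbb{N}$, each combinatorially equivalent to $K$.
   Context: For a locally finite set $X\subset\mathbb{R}^d$, $\mathrm{VR}(X,\rho)$ is the abstract simplicial complex on vertex set $X$ whose simplices are the finite subsets $\{x_0,\dots,x_k\}\subset X$ with $\|x_i-x_j\|_2\le\rho$ for all $i,j$. A stationary Poisson point process $\eta$ on $\mathbb{R}^d$ with intensity $t$ is a Poisson point process with intensity measure $t\Lambda_d$ ($\Lambda_d$ = Lebesgue measure); $\mathrm{VR}(\eta,\rho)$ denotes $\mathrm{VR}$ of its (a.s. locally finite) random support $\{x:\eta(\{x\})>0\}$. Two simplicial complexes are combinatorially equivalent if there is a bijection of vertex sets mapping faces exactly onto faces. An isolated subcomplex is an induced subcomplex on a vertex set $W$ such that no edge of the ambient complex joins a vertex of $W$ to a vertex outside $W$. *)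

(* Defs.v *)
From HB Require Import structures.
From mathcomp Require Import all_boot all_order all_algebra.
From mathcomp Require Import all_classical all_reals all_analysis measurable_realfun.

Set Implicit Arguments.
Unset Strict Implicit.
Unset Printing Implicit Defensive.

Import Order.TTheory GRing.Theory Num.Theory.
Import numFieldNormedType.Exports.

Local Open Scope classical_set_scope.
Local Open Scope ring_scope.

(** Euclidean space: [eucl R d] carries the library's product sigma-algebra,
    generated by the coordinates, which is the Borel sigma-algebra of R^d. *)

Notation eucl R d := (d.-tuple (measurableTypeR R)).

Definition eucl_dist (R : realType) (d : nat) (x y : eucl R d) : R :=
  Num.sqrt (\sum_(i < d) (tnth x i - tnth y i) ^+ 2).

(** Lebesgue measure on R^d is the d-fold product of [lebesgue_measure]. *)

Section lebesgue_cons.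
Variables (R : realType) (n : nat).
Variable mu : {sigma_finite_measure set (eucl R n) -> \bar R}.

Definition cons_eucl (p : measurableTypeR R * eucl R n) : eucl R n.+1 :=
  [the n.+1.-tuple (measurableTypeR R) of p.1 :: p.2].

Lemma measurable_cons_eucl : measurable_fun [set: _] cons_eucl.
Proof. exact: measurable_cons. Qed.

Definition lebesgue_cons : set (eucl R n.+1) -> \bar R :=
  pushforward (@lebesgue_measure R \x mu)%E cons_eucl.

Let pushed : {measure set (eucl R n.+1) -> \bar R} :=
  measure_function_pushforward__canonical__measure_function_Measure
    (@lebesgue_measure R \x mu)%E measurable_cons_eucl.

Let lebesgue_cons0 : lebesgue_cons set0 = 0%E.
Proof. exact: (measure0 pushed). Qed.

Let lebesgue_cons_ge0 A : (0 <= lebesgue_cons A)%E.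
Proof. exact: (measure_ge0 pushed). Qed.

Let lebesgue_cons_sigma_additive : semi_sigma_additive lebesgue_cons.
Proof. exact: (@measure_semi_sigma_additive _ _ _ pushed). Qed.

HB.instance Definition _ := isMeasure.Build _ _ _ lebesgue_cons
  lebesgue_cons0 lebesgue_cons_ge0 lebesgue_cons_sigma_additive.

Lemma sigma_finite_lebesgue_cons : sigma_finite [set: eucl R n.+1] lebesgue_cons.
Proof.
have /sigma_finiteP[F [FT ndF Foo]] := sigma_finiteT (@lebesgue_measure R).
have /sigma_finiteP[G [GT ndG Goo]] := sigma_finiteT mu.
pose uncons (x : eucl R n.+1) : measurableTypeR R * eucl R n :=
  (thead x, [tuple of behead x]).
have consK : cancel cons_eucl uncons.
  by move=> [a s]; rewrite /uncons/= theadE; congr pair; exact/val_inj.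
have munc : measurable_fun [set: _] uncons.
  apply/measurable_fun_pair; first exact: measurable_tnth.
  exact: measurable_behead.
exists (fun i => uncons @^-1` (F i `*` G i)).
  apply/seteqP; split=> // x _.
  have [i _ Fi] : (\bigcup_i F i) (uncons x).1 by rewrite -FT.
  have [j _ Gj] : (\bigcup_i G i) (uncons x).2 by rewrite -GT.
  exists (maxn i j) => //; split.
  - by move: Fi; exact/subsetPset/ndF/leq_maxl.
  - by move: Gj; exact/subsetPset/ndG/leq_maxr.
move=> i; have [mF Fi] := Foo i; have [mG Gi] := Goo i; split.
  by rewrite -[X in measurable X]setTI; apply: munc => //; exact: measurableX.
rewrite /lebesgue_cons /pushforward -comp_preimage.
rewrite [X in X @^-1` _](_ : _ = id); last by apply/funext => p /=; exact: consK.
by rewrite product_measure1E// lte_mul_pinfty// ge0_fin_numE.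
Qed.

HB.instance Definition _ :=
  @Measure_isSigmaFinite.Build _ _ _ lebesgue_cons sigma_finite_lebesgue_cons.

End lebesgue_cons.

Fixpoint lebesgue_eucl (R : realType) (d : nat) :
    {sigma_finite_measure set (eucl R d) -> \bar R} :=
  match d with
  | 0 => dirac [tuple]
  | n.+1 => lebesgue_cons (lebesgue_eucl R n)
  end.

Lemma lebesgue_eucl_box (R : realType) (d : nat)
    (A : 'I_d -> set (measurableTypeR R)) :
  (forall i, measurable (A i)) ->
  lebesgue_eucl R d [set x | forall i, A i (tnth x i)] =
  (\prod_(i < d) lebesgue_measure (A i))%E.
Proof.
elim: d A => [|d IHd] A mA.
  by rewrite big_ord0 /= diracE mem_set// => -[].
rewrite big_ord_recl -(IHd (A \o lift ord0))//=.
rewrite /lebesgue_cons /pushforward.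
have mB : measurable [set x : eucl R d | forall i, A (lift ord0 i) (tnth x i)].
  rewrite [X in measurable X](_ : _ =
    \bigcap_(i in [set: 'I_d]) ((@tnth _ _)^~ i @^-1` A (lift ord0 i))).
    apply: fin_bigcap_measurable => // i _.
    by rewrite -[X in measurable X]setTI; exact: measurable_tnth.
  by apply/seteqP; split => x /= h i; [move=> _; exact: h|exact: h].
rewrite -product_measure1E//; congr product_measure1.
apply/seteqP; split => -[a x] /=.
- move=> h; split; first by have := h ord0.
  by move=> i; have := h (lift ord0 i); rewrite tnthS.
- move=> [h0 h] i; case: (unliftP ord0 i) => [j ->|->//].
  by rewrite tnthS; exact: h.
Qed.

Section point_process.
Local Open Scope ereal_scope.
Context (R : realType) {d1 d2 : measure_display}.
Context (Omega : measurableType d1) (T : measurableType d2).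
Variable P : probability Omega R.

Definition integer_measure (m : set T -> \bar R) : Prop :=
  forall B, measurable B -> exists k : nat, m B = k%:R%:E.

(* A kernel is a random measure; it is a point process when its values are
   countable sums of finite integer-valued measures. *)
Definition point_process (eta : R.-ker Omega ~> T) : Prop :=
  forall w, exists2 m : {measure set T -> \bar R}^nat,
    (forall i, integer_measure (m i)) &
    (forall B, measurable B -> eta w B = mseries m 0 B).

(* The product rule for subfamilies is the case where some [A i] are [setT]. *)
Definition mutually_independent (n : nat) (X : 'I_n -> Omega -> \bar R) :=
  forall A : 'I_n -> set (\bar R), (forall i, measurable (A i)) ->
    P (\bigcap_(i in [set: 'I_n]) (X i @^-1` A i)) =
    \prod_(i < n) P (X i @^-1` A i).

(* The second argument of [poisson_prob] is a dummy; at rate 0, it is the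
   Dirac measure at 0. *)
Definition poisson_process (mu : set T -> \bar R) (eta : R.-ker Omega ~> T) :=
  [/\ point_process eta,
      forall B, measurable B -> mu B < +oo -> forall k : nat,
        P [set w | eta w B = k%:R%:E] = poisson_prob (fine (mu B)) 0%N [set k],
      forall B, measurable B -> mu B = +oo ->
        P [set w | eta w B = +oo] = 1 &
      forall (n : nat) (B : 'I_n -> set T), (forall i, measurable (B i)) ->
        trivIset [set: 'I_n] B ->
        mutually_independent (fun i w => eta w (B i))].

Definition support_points (m : set T -> \bar R) : set T :=
  [set x | 0 < m [set x]].

End point_process.

Definition stationary_poisson_process (R : realType) (d : nat)
    (disp : measure_display) (Omega : measurableType disp)
    (P : probability Omega R) (t : R) (eta : R.-ker Omega ~> eucl R d) :=
  poisson_process P (fun B => t%:E * lebesgue_eucl R d B)%E eta.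

(** Abstract simplicial complexes (the empty set is not a simplex). *)

Record simplicial_complex (T : Type) := SimplicialComplex {
  vertices : set T;
  simplices : set (set T);
  simplex_finite : forall s, simplices s -> finite_set s;
  simplex_neq0 : forall s, simplices s -> s !=set0;
  simplex_vertices : forall s, simplices s -> s `<=` vertices;
  simplex_vertex : forall x, vertices x -> simplices [set x];
  simplex_face : forall s s', simplices s -> s' `<=` s -> s' !=set0 ->
    simplices s'
}.

Section complexes.
Variable T : Type.
Implicit Types (K L : simplicial_complex T) (W : set T).

Definition induced_simplices K W : set (set T) :=
  [set s | simplices K s /\ s `<=` W].

Program Definition induced_subcomplex K W : simplicial_complex T :=
  @SimplicialComplex T (vertices K `&` W) (induced_simplices K W) _ _ _ _ _.
Next Obligation. by move=> K W s [/simplex_finite]. Qed.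
Next Obligation. by move=> K W s [/simplex_neq0]. Qed.
Next Obligation.
by move=> K W s [/simplex_vertices sK sW] x sx; split; [exact: sK|exact: sW].
Qed.
Next Obligation.
by move=> K W x [Kx Wx]; split; [exact: simplex_vertex|move=> _ ->].
Qed.
Next Obligation.
move=> K W s s' [Ks sW] s's s'0; split; first exact: simplex_face s's s'0.
exact: subset_trans sW.
Qed.

Definition isolated_subcomplex L K : Prop :=
  exists W, [/\ W `<=` vertices K, L = induced_subcomplex K W &
    forall x y, W x -> vertices K y -> ~ W y -> ~ simplices K [set x; y]].

End complexes.

Definition comb_equiv (T U : Type) (K : simplicial_complex T)
    (L : simplicial_complex U) : Prop :=
  exists2 f : T -> U, set_bij (vertices K) (vertices L) f &
    forall s, s `<=` vertices K -> (simplices K s <-> simplices L (f @` s)).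

Section vietoris_rips.
Variables (R : realType) (d : nat).

Definition VR_simplices (X : set (eucl R d)) (rho : R) : set (set (eucl R d)) :=
  [set s | [/\ finite_set s, s !=set0, s `<=` X &
    forall x y, s x -> s y -> eucl_dist x y <= rho]].

Lemma eucl_distxx (x : eucl R d) : eucl_dist x x = 0.
Proof.
by rewrite /eucl_dist big1 ?sqrtr0// => i _; rewrite subrr expr0n.
Qed.

(* A nonnegative radius makes every vertex a simplex. *)
Program Definition VR (X : set (eucl R d)) (rho : R) (rho0 : 0 <= rho) :
    simplicial_complex (eucl R d) :=
  @SimplicialComplex _ X (VR_simplices X rho) _ _ _ _ _.
Next Obligation. by move=> X rho rho0 s []. Qed.
Next Obligation. by move=> X rho rho0 s []. Qed.
Next Obligation. by move=> X rho rho0 s []. Qed.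
Next Obligation.
move=> X rho rho0 x Xx; split => //; first by exists x.
- by move=> _ ->.
- by move=> _ _ -> ->; rewrite eucl_distxx.
Qed.
Next Obligation.
move=> X rho rho0 s s' [fs _ sX h] s's s'0; split => //.
- exact: sub_finite_set fs.
- exact: subset_trans sX.
- by move=> x y /s's sx /s's sy; exact: h.
Qed.

End vietoris_rips.

(* Main.v *)
Require Import Defs.
From HB Require Import structures.
From mathcomp Require Import all_boot all_order all_algebra.
From mathcomp Require Import all_classical all_reals all_analysis measurable_realfun.
From mathcomp Require Import ring lra.

(** Shrink [V] by a factor [l < 1] close to 1: no distance is then equal to
    [rho], and the distance graph at scale [rho] is unchanged, even if each
    point is replaced by any point of a small cube around it. Place a copy of
    these cubes inside each of infinitely many disjoint large boxes. When every
    cube of the [n]-th copy carries exactly one point of the process and the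
    rest of the [n]-th box is empty, these points span an isolated copy of [K].
    These events are independent and their probabilities are bounded below, so
    infinitely many of them occur almost surely by the second Borel-Cantelli
    lemma. *)

Set Implicit Arguments.
Unset Strict Implicit.
Unset Printing Implicit Defensive.

Import Order.TTheory GRing.Theory Num.Theory.
Import numFieldNormedType.Exports.

Local Open Scope classical_set_scope.
Local Open Scope ring_scope.

(** * The second Borel-Cantelli lemma *)

Section second_borel_cantelli.
Context (R : realType) (d : measure_display) (T : measurableType d).
Variables (P : probability T R) (A : nat -> set T) (p : nat -> R).
Hypothesis mA : forall i, measurable (A i).
Hypothesis indepA : forall s, uniq s ->
  P (\big[setI/setT]_(i <- s) A i) = (\prod_(i <- s) p i)%:E.

Lemma measurable_bigsetI (I : Type) (s : seq I) (B : I -> set T) :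
  (forall i, measurable (B i)) -> measurable (\big[setI/setT]_(i <- s) B i).
Proof. by move=> mB; apply: big_ind => //; exact: measurableI. Qed.

(* P(~A_a & X) = P(X) - P(A_a & X) moves an index [a] from [u] to [t]. *)
Lemma independent_setC (u t : seq nat) : uniq (u ++ t) ->
  P (\big[setI/setT]_(i <- u) (~` A i) `&` \big[setI/setT]_(i <- t) A i) =
  (\prod_(i <- u) (1 - p i) * \prod_(i <- t) p i)%:E.
Proof.
elim: u t => [|a u IH] t ut.
  by rewrite !big_nil setTI mul1r indepA.
set X := \big[setI/setT]_(i <- u) ~` A i `&` \big[setI/setT]_(i <- t) A i.
have mX : measurable X.
  by apply: measurableI; apply: measurable_bigsetI => // i; exact: measurableC.
have uat : uniq (u ++ a :: t) by rewrite -(uniq_catCA [:: a]).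
have ut' : uniq (u ++ t) by case/andP: ut.
rewrite big_cons -setIA -/X setIC -setDE measureD//; last first.
  by rewrite -ge0_fin_numE// fin_num_measure.
have -> : X `&` A a =
    \big[setI/setT]_(i <- u) ~` A i `&` \big[setI/setT]_(i <- a :: t) A i.
  by rewrite big_cons /X -setIA (setIC _ (A a)).
rewrite [X in (X - _)%E](IH _ ut') [X in (_ - X)%E](IH _ uat) -EFinB.
by rewrite !big_cons; congr EFin; ring.
Qed.

(** If no event from [N] on occurs, then in particular [M] independent events fail, which has
    probability at most [(1 - q) ^+ M]; let [M] grow. The uniform bound [q] stands in for a
    divergent series. *)
Lemma second_borel_cantelli (q : R) : 0 < q -> (forall i, q <= p i) ->
  {ae P, forall w, forall N, exists2 n, (N <= n)%N & A n w}.
Proof.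
move=> q0 qp.
(* On a one-element sequence, [indepA] says that [p i] is the probability of [A i]. *)
have p1 i : p i <= 1.
  have := indepA (isT : uniq [:: i]); rewrite !big_seq1 => Pi.
  by rewrite -lee_fin -Pi probability_le1.
pose E N := \bigcap_(i in [set i | (N <= i)%N]) ~` A i.
suff nE N : P.-negligible (E N).
  have := negligible_bigcup nE; apply: negligibleS => w /= /existsNP[N hN].
  exists N => // i Ni Ai; exact: hN (ex_intro2 _ _ i Ni Ai).
have mE : measurable (E N).
  by apply: bigcap_measurable => [|i _]; [exists N => /=|exact: measurableC].
apply/negligibleP => //.
have bound M : (P (E N) <= ((1 - q) ^+ M)%:E)%E.
  have mI : measurable (\big[setI/setT]_(i <- iota N M) ~` A i).
    by apply: measurable_bigsetI => i; exact: measurableC.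
  apply: (@le_trans _ _ (P (\big[setI/setT]_(i <- iota N M) ~` A i))).
    apply: le_measure; rewrite ?inE// => w Ew.
    rewrite -bigcap_seq => i /=; rewrite mem_iota => /andP[Ni _].
    exact: Ew.
  have := @independent_setC (iota N M) [::].
  rewrite cats0 iota_uniq => /(_ isT).
  rewrite !big_nil setIT mulr1 => ->; rewrite lee_fin.
  rewrite -[leRHS](_ : \prod_(i <- iota N M) (1 - q) = _); last first.
    by rewrite big_const_seq count_predT size_iota iter_mulr_1.
  by apply: ler_prod => i _; rewrite subr_ge0 p1 lerB.
have q1 : q <= 1 by rewrite (le_trans (qp 0%N)).
have PE : P (E N) = (fine (P (E N)))%:E by rewrite fineK// fin_num_measure.
apply/eqP; rewrite eq_le measure_ge0 andbT.
suff : fine (P (E N)) <= 0 by rewrite -lee_fin -PE.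
have cvq : (1 - q) ^+ n @[n --> \oo] --> (0 : R).
  by apply: cvg_expr; rewrite ger0_norm ?subr_ge0// ltrBlDr ltrDl.
rewrite -(cvg_lim _ cvq)//; apply: limr_ge; first by apply/cvg_ex; exists 0.
by near=> n; rewrite -lee_fin -PE.
Unshelve. all: by end_near.
Qed.

End second_borel_cantelli.

(** * Counts and atoms of point processes *)

(** Transfers independence from families indexed by ordinals to arbitrary keys: [s] is indexed by
    position, and [uniq s] keeps the sets at distinct positions disjoint. *)
Lemma poisson_counts_independent (R : realType) (d1 d2 : measure_display)
    (Omega : measurableType d1) (T : measurableType d2)
    (P : probability Omega R) (mu : set T -> \bar R) (eta : R.-ker Omega ~> T)
    (K : choiceType) (B : K -> set T) (c : K -> nat) (s : seq K) :
  poisson_process P mu eta -> (forall k, measurable (B k)) ->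
  trivIset [set: K] B -> uniq s ->
  P (\big[setI/setT]_(k <- s) [set w | eta w (B k) = (c k)%:R%:E]) =
  (\prod_(k <- s) P [set w | eta w (B k) = (c k)%:R%:E])%E.
Proof.
move=> [_ _ _ indep] mB tB us.
pose b i := tnth (in_tuple s) i.
transitivity
    (P (\bigcap_(i in [set: 'I_(size s)])
      [set w | eta w (B (b i)) = (c (b i))%:R%:E])).
  congr (P _); rewrite big_tnth -bigcap_seq; apply/seteqP; split => w h i /=.
    by move=> _; apply: h => /=; rewrite mem_index_enum.
  by move=> _; exact: h.
have tBb : trivIset [set: 'I_(size s)] (B \o b).
  move=> i j _ _ /(tB _ _ I I).
  exact: (tuple_uniqP (in_tuple s) us).
have mc (i : 'I_(size s)) : measurable [set ((c (b i))%:R : R)%:E].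
  exact: emeasurable_set1.
have := indep _ (B \o b) (fun i => mB (b i)) tBb
  (fun i => [set (c (b i))%:R%:E]) mc.
move=> H; rewrite [RHS]big_tnth; exact: H.
Qed.

(** A nonzero countable sum of natural numbers has a term that is at least 1. *)
Lemma point_process_ge1 (R : realType) (d1 d2 : measure_display)
    (Omega : measurableType d1) (T : measurableType d2)
    (eta : R.-ker Omega ~> T) (w : Omega) (B : set T) :
  point_process eta -> measurable B -> eta w B <> 0%E -> (1 <= eta w B)%E.
Proof.
move=> /(_ w)[m im mE] mB; rewrite mE//.
rewrite /mseries => /eqP; apply: contra_neqP => /negP; rewrite -ltNge => sm.
apply: eseries0 => i _ _; have [[|k] mk] := im i B mB; first by rewrite mk.
move: sm; rewrite ltNge => /negP; case.
apply: (le_trans _ (nneseries_lim_ge i.+1 _)) => [|n _ _]; last exact: measure_ge0.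
rewrite big_nat_recr//= mk -[leLHS]add0e leeD//; last by rewrite lee_fin ler1n.
by apply: sume_ge0 => n _; exact: measure_ge0.
Qed.

(* Each [H k] splits an atom [C] of mass 1 into a null part and a full part;
   the null parts cover all of [C] but a single point. *)
Lemma unit_atom_point (R : realType) (d : measure_display)
    (T : measurableType d) (m : {measure set T -> \bar R}) (H : nat -> set T)
    (C : set T) :
  (forall k, measurable (H k)) -> (forall x : T, measurable [set x]) ->
  (forall x y, x <> y -> exists k,
    H k x /\ ~ H k y \/ ~ H k x /\ H k y) ->
  (forall B : set T, measurable B -> m B <> 0%E -> (1 <= m B)%E) ->
  measurable C -> m C = 1%E ->
  exists x, [/\ C x, (0 < m [set x])%E &
    forall y, C y -> (0 < m [set y])%E -> y = x].
Proof.
move=> mH m1 sepH int mC C1.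
have /choice[Z nZ] k : exists Z, m.-negligible Z /\
    (Z = C `&` H k \/ Z = C `\` H k).
  have mCH : measurable (C `&` H k) by exact: measurableI.
  have mCD : measurable (C `\` H k) by exact: measurableD.
  have [CH0|CH0] := pselect (m (C `&` H k) = 0%E).
    by exists (C `&` H k); split; [apply/negligibleP|left].
  exists (C `\` H k); split; last by right.
  apply/negligibleP => //; apply: contrapT => /(int _ mCD) CD1.
  have : (1 + 1 <= m C)%E.
    rewrite -[in leRHS](setUIDK C (H k)) measureU//; last first.
      by rewrite setDE setIACA setICr setI0.
    by rewrite leeD//; exact: int.
  by rewrite C1 -EFinD lee_fin; lra.
pose N := \bigcup_k Z k.
have nN : m.-negligible N by apply: negligible_bigcup => k; exact: (nZ k).1.
have [x [Cx Nx]] : exists x, C x /\ ~ N x.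
  apply: contrapT => /forallNP h.
  have : m.-negligible C.
    by apply: negligibleS nN => x Cx; apply: contrapT => ?; exact: (h x).
  move=> /negligibleP => /(_ mC) C0; have := etrans (esym C1) C0.
  by move/eqP; rewrite eqe oner_eq0.
(* Some [H k] separates [y] from [x]; since [x] avoids the null part [Z k], it is [y] that lies in
   it. *)
have CN y : C y -> y <> x -> N y.
  move=> Cy yx; have [k hk] := sepH _ _ yx; exists k => //.
  have : ~ Z k x by move=> ?; apply: Nx; exists k.
  have [_ [] ->] := nZ k; move=> Zx; case: hk => -[h1 h2].
  - by [].
  - by case: Zx.
  - by case: Zx.
  - by [].
have n1 y : C y -> y <> x -> m [set y] = 0%E.
  move=> Cy yx; apply/negligibleP => //; apply: negligibleS nN => _ ->.
  exact: CN.
(* All other points of [C] lie in the one null set [N], so [x] carries the whole mass, although [C]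
   may be uncountable. *)
have mCx : m (C `\` [set x]) = 0%E.
  apply/negligibleP; first exact: measurableD.
  by apply: negligibleS nN => y [Cy yx]; exact: CN.
exists x; split => //; last first.
  by move=> y Cy y0; apply: contrapT => /(n1 _ Cy) y1; rewrite y1 ltxx in y0.
have : m C = m [set x].
  have Cx1 : C `&` [set x] = [set x].
    by apply/seteqP; split => [y []|_ ->].
  rewrite -[in LHS](setUIDK C [set x]) Cx1 measureU//; last 2 first.
  - exact: measurableD.
  - by rewrite setDE setIC -setIA setICl setI0.
  by rewrite [X in (_ + X)%E]mCx adde0.
by rewrite C1 => <-.
Qed.

(** * Measurable sets and separation of points in R^d *)

Lemma measurable_eucl_forall (R : realType) (d : nat)
    (A : 'I_d -> set (measurableTypeR R)) : (forall i, measurable (A i)) ->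
  measurable [set x : eucl R d | forall i, A i (tnth x i)].
Proof.
move=> mA; rewrite [X in measurable X](_ : _ =
    \bigcap_(i in [set: 'I_d]) ((@tnth _ _)^~ i @^-1` A i)).
  apply: fin_bigcap_measurable => // i _.
  by rewrite -[X in measurable X]setTI; exact: measurable_tnth.
by apply/seteqP; split => x /= h i; [move=> _; exact: h|exact: h].
Qed.

Lemma measurable_eucl1 (R : realType) (d : nat) (x : eucl R d) :
  measurable [set x].
Proof.
rewrite (_ : [set x] = [set y | forall i, [set tnth x i] (tnth y i)]).
  apply: (measurable_eucl_forall (A := fun i => [set tnth x i])) => i.
  exact: measurable_set1.
by apply/seteqP; split => [_ -> //|y /= h]; exact: eq_from_tnth.
Qed.

(** A countable point-separating family, as [unit_atom_point] requires. Numbers that code no pair of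
    a coordinate and a rational give the whole space, which is harmless. *)
Definition rational_halfspace (R : realType) (d : nat) (k : nat) :
    set (eucl R d) :=
  if (unpickle k : option ('I_d * rat)) is Some (i, q)
  then [set x | tnth x i <= ratr q] else setT.

Lemma measurable_rational_halfspace (R : realType) (d k : nat) :
  measurable (@rational_halfspace R d k).
Proof.
rewrite /rational_halfspace; case: unpickle => [[i q]|//].
rewrite (_ : [set x : eucl R d | _] = (@tnth _ _)^~ i @^-1` `]-oo, ratr q]).
  rewrite -[X in measurable X]setTI.
  have mI : @measurable _ (measurableTypeR R) `]-oo, ratr q] by [].
  exact: (@measurable_tnth _ (measurableTypeR R) d i measurableT _ mI).
by apply/seteqP; split => x /=; rewrite in_itv.
Qed.

Lemma rational_halfspace_separates (R : realType) (d : nat) (x y : eucl R d) :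
  x <> y -> exists k : nat, rational_halfspace k x /\ ~ rational_halfspace k y \/
    ~ rational_halfspace k x /\ rational_halfspace k y.
Proof.
move=> xy; have [i] : exists i, tnth x i <> tnth y i.
  by apply: contrapT => /forallNP h; apply/xy/eq_from_tnth => i; exact: contrapT.
move=> /eqP; rewrite neq_lt => /orP[] /rat_in_itvoo[q];
  rewrite in_itv/= => /andP[q1 q2];
  exists (pickle (i, q)); rewrite /rational_halfspace pickleK /=; [left|right].
- by split; [exact: ltW|apply/negP; rewrite -ltNge].
- by split; [apply/negP; rewrite -ltNge|exact: ltW].
Qed.

(** * Cubes and the stability of the distance graph *)

Section eucl_geometry.
Context (R : realType) (d : nat).
Implicit Types x y v w : eucl R d.

Definition sqdist x y : R := \sum_(i < d) (tnth x i - tnth y i) ^+ 2.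

Lemma sqdist_ge0 x y : 0 <= sqdist x y.
Proof. by apply: sumr_ge0 => i _; exact: sqr_ge0. Qed.

Lemma sqdist_gt0 x y : x <> y -> 0 < sqdist x y.
Proof.
move=> xy; rewrite lt_neqAle sqdist_ge0 andbT eq_sym; apply/eqP => xy0.
apply/xy/eq_from_tnth => i; apply/eqP; rewrite -subr_eq0 -sqrf_eq0.
by rewrite (psumr_eq0P _ xy0)// => j _; exact: sqr_ge0.
Qed.

Lemma eucl_dist_le x y (r : R) : 0 <= r ->
  (eucl_dist x y <= r) = (sqdist x y <= r ^+ 2).
Proof.
by move=> r0; rewrite -[in LHS](ger0_norm r0) -sqrtr_sqr ler_sqrt// sqr_ge0.
Qed.

Lemma coord_dist_le x y i : `|tnth x i - tnth y i| <= eucl_dist x y.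
Proof.
rewrite -sqrtr_sqr ler_sqrt ?sqdist_ge0// (bigD1 i)//= lerDl.
by apply: sumr_ge0 => j _; exact: sqr_ge0.
Qed.

Definition cube (c : 'I_d -> R) (r : R) : set (eucl R d) :=
  [set x | forall i, `[c i - r, c i + r]%classic (tnth x i)].

Lemma cubeP (c : 'I_d -> R) (r : R) x :
  cube c r x <-> forall i, `|tnth x i - c i| <= r.
Proof.
by split=> h i; have := h i; rewrite /= in_itv/= ler_distl.
Qed.

Lemma measurable_cube (c : 'I_d -> R) (r : R) : measurable (cube c r).
Proof.
apply: (@measurable_eucl_forall _ _ (fun i => `[c i - r, c i + r]%classic)) => i.
exact: measurable_itv. Qed.

Lemma lebesgue_eucl_cube (c : 'I_d -> R) (r : R) : 0 < r ->
  lebesgue_eucl R d (cube c r) = ((r *+ 2) ^+ d)%:E.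
Proof.
move=> r0; rewrite (lebesgue_eucl_box (A := fun i => `[c i - r, c i + r]%classic));
  last by move=> i; exact: measurable_itv.
rewrite (eq_bigr (fun _ => (r *+ 2)%:E)); last first.
  move=> i _; rewrite lebesgue_measure_itv/= lte_fin.
  rewrite ifT; last by rewrite ltrD2l; lra.
  by rewrite -EFinD; congr EFin; rewrite mulr2n; ring.
by rewrite prodEFin big_const_ord iter_mulr_1.
Qed.

(** In each coordinate the shift [c] cancels, and the difference [h] between [a - b] and [l * s] is
    at most [2 * e]; then factor the difference of squares as [h * (h + 2 * l * s)]. The bound is
    linear in [e], with a coefficient depending only on [v] and [w]. *)
Lemma sqdist_perturb v w (l e : R) x y (c : R) :
  0 <= e <= 1 -> 0 <= l <= 1 ->
  cube (fun i => l * tnth v i + c) e x -> cube (fun i => l * tnth w i + c) e y ->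
  `|sqdist x y - l ^+ 2 * sqdist v w| <=
    e * \sum_(i < d) (4 * `|tnth v i - tnth w i| + 4).
Proof.
move=> /andP[e0 e1] /andP[l0 l1] /cubeP hx /cubeP hy.
rewrite /sqdist !mulr_sumr -sumrB (le_trans (ler_norm_sum _ _ _))//.
apply: ler_sum => i _; have := hx i; have := hy i.
set a := tnth x i; set b := tnth y i; set v' := tnth v i; set w' := tnth w i.
set s := v' - w'; set h := (a - b) - l * s => bw av.
have h2 : `|h| <= 2 * e.
  rewrite (_ : h = (a - (l * v' + c)) - (b - (l * w' + c))); last first.
    by rewrite /h /s; ring.
  by rewrite (le_trans (ler_normB _ _))//; lra.
rewrite (_ : _ - _ = h * (h + 2 * l * s)); last by rewrite /h; ring.
rewrite normrM.
have h3 : `|h + 2 * l * s| <= 2 + 2 * `|s|.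
  rewrite (le_trans (ler_normD _ _))// lerD//; first by lra.
  rewrite normrM ger0_norm; last by lra.
  by rewrite ler_wpM2r//; lra.
rewrite (le_trans (ler_pM _ _ h2 h3))//.
by rewrite le_eqVlt; apply/orP; left; apply/eqP; ring.
Qed.

(* Shrinking by [l < 1] makes all edges strictly shorter than [rho], so that
   small cubes around the shrunk points can replace them. *)
Lemma stable_representation (I : finType) (v : I -> eucl R d) (rho : R) :
  injective v -> 0 < rho ->
  exists2 l : R, 0 <= l <= 1 & exists2 e : R, 0 < e <= 1 &
    forall (c : R) i j x y,
      cube (fun k => l * tnth (v i) k + c) e x ->
      cube (fun k => l * tnth (v j) k + c) e y ->
      (eucl_dist x y <= rho <-> eucl_dist (v i) (v j) <= rho) /\
      (i <> j -> x <> y).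
Proof.
move=> vinj rho0; pose S i j := sqdist (v i) (v j).
have S0 i j : 0 <= S i j by exact: sqdist_ge0.
(* Pairs farther apart than [rho] stay so for [l] close to 1; there are finitely many pairs, so one
   [l] serves them all. *)
have [l l01 lP] : exists2 l : R, 0 < l < 1 &
    forall ij : I * I, rho ^+ 2 < S ij.1 ij.2 -> rho ^+ 2 < l ^+ 2 * S ij.1 ij.2.
  suff nearP : \forall l \near (1 : R)^'-, forall ij : I * I,
      rho ^+ 2 < S ij.1 ij.2 -> rho ^+ 2 < l ^+ 2 * S ij.1 ij.2.
    near (1 : R)^'- => l; exists l; last by near: l.
    by apply/andP; split; near: l; [exact: nbhs_left_gt|exact: nbhs_left_lt].
  apply: filter_forall => -[i j] /=.
  have [ltS|] := ltP (rho ^+ 2) (S i j); last first.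
    by move=> ?; apply: nearW.
  have cvS : (l ^+ 2 * S i j) @[l --> (1:R)^'-] --> 1 ^+ 2 * S i j.
    apply: cvg_at_left_filter; apply: cvgM; last exact: cvg_cst.
    exact: exprn_continuous.
  have : \forall l \near (1:R)^'-, rho ^+ 2 < l ^+ 2 * S i j.
    by apply: (cvgr_gt _ cvS); rewrite expr1n mul1r.
  exact: filterS.
have /andP[l0 l1] := l01.
(* [C] is the coefficient of [e] in [sqdist_perturb], and [t] the squared distance after
   shrinking. *)
pose C i j := \sum_(k < d) (4 * `|tnth (v i) k - tnth (v j) k| + 4).
pose t i j := l ^+ 2 * S i j.
(* The three conditions keep edges, keep non-edges, and keep distinct points distinct under
   perturbation. *)
have [e e01 eP] : exists2 e : R, 0 < e < 1 & forall ij : I * I,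
    [/\ t ij.1 ij.2 < rho ^+ 2 -> e * C ij.1 ij.2 < rho ^+ 2 - t ij.1 ij.2,
        rho ^+ 2 < t ij.1 ij.2 -> e * C ij.1 ij.2 < t ij.1 ij.2 - rho ^+ 2 &
        0 < t ij.1 ij.2 -> e * C ij.1 ij.2 < t ij.1 ij.2].
  suff nearP : \forall e \near (0 : R)^'+, forall ij : I * I,
    [/\ t ij.1 ij.2 < rho ^+ 2 -> e * C ij.1 ij.2 < rho ^+ 2 - t ij.1 ij.2,
        rho ^+ 2 < t ij.1 ij.2 -> e * C ij.1 ij.2 < t ij.1 ij.2 - rho ^+ 2 &
        0 < t ij.1 ij.2 -> e * C ij.1 ij.2 < t ij.1 ij.2].
    near (0 : R)^'+ => e; exists e; last by near: e.
    by apply/andP; split; near: e; [exact: nbhs_right_gt|exact: nbhs_right_lt].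
  apply: filter_forall => -[i j] /=.
  have lim (b : R) : \forall e \near (0 : R)^'+, 0 < b -> e * C i j < b.
    have cvC : (e * C i j) @[e --> (0:R)^'+] --> 0 * C i j.
      by apply: cvg_at_right_filter; apply: cvgM; [exact: cvg_id|exact: cvg_cst].
    have [b0|b0] := ltP 0 b; last by apply: nearW.
    have : \forall e \near (0:R)^'+, e * C i j < b.
      by apply: (cvgr_lt _ cvC); rewrite mul0r.
    exact: filterS.
  have lim1 := lim (rho ^+ 2 - t i j); have lim2 := lim (t i j - rho ^+ 2).
  near=> e; split; last by near: e; exact: lim.
  - by rewrite -subr_gt0; near: e.
  - by rewrite -subr_gt0; near: e.
have /andP[e0 e1] := e01.
exists l; first by rewrite !ltW.
exists e; first by rewrite e0 ltW.
move=> c i j x y hx hy.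
have lS : l ^+ 2 < 1 by rewrite expr_lt1// ltW.
have [eP1 eP2 eP3] := eP (i, j); have lPij := lP (i, j).
rewrite /= in eP1 eP2 eP3 lPij.
have e01' : 0 <= e <= 1 by rewrite !ltW.
have l01' : 0 <= l <= 1 by rewrite !ltW.
have := sqdist_perturb e01' l01' hx hy.
rewrite -/(C i j) -/(S i j) -/(t i j) => pert.
have /andP[pert1 pert2] : (t i j - e * C i j <= sqdist x y <= t i j + e * C i j).
  by rewrite -ler_distl.
have rho20 : 0 < rho ^+ 2 by rewrite exprn_gt0.
split; last first.
  move=> ij xy.
  have tij : 0 < t i j.
    by rewrite mulr_gt0 ?exprn_gt0//; apply: sqdist_gt0 => /vinj.
  have xx : sqdist x y = 0.
    by rewrite xy /sqdist big1// => k _; rewrite subrr expr0n.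
  by have := eP3 tij; lra.
rewrite !eucl_dist_le; try exact: ltW.
rewrite -/(S i j); split=> [xy|vij].
  rewrite leNgt; apply/negP => /lPij h.
  have := eP2 h; lra.
(* Shrinking is strict unless the distance is 0, where [rho > 0] gives strictness. *)
have : t i j < rho ^+ 2.
  have := S0 i j; rewrite le_eqVlt => /orP[/eqP s0|s0].
    by rewrite /t -s0 mulr0.
  by apply: (lt_le_trans _ vij); rewrite gtr_pMl.
by move=> /eP1; lra.
Unshelve. all: by end_near.
Qed.

End eucl_geometry.

(** * From a pattern of points to an isolated copy *)

(** Neighbours of points in the cells [Q i] lie in [B], where [X] has no points outside the cells:
    this gives isolation. Sending the unique point of [X] in [Q i] to [v i] gives the equivalence,
    since a simplex is determined by pairwise distances. *)
Lemma isolated_VR_copy (R : realType) (d : nat) (rho : R) (rho0 : 0 <= rho)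
    (I : Type) (v : I -> eucl R d) (Q : I -> set (eucl R d))
    (B X : set (eucl R d)) :
  injective v ->
  (forall i j x y, Q i x -> Q j y ->
    (eucl_dist x y <= rho <-> eucl_dist (v i) (v j) <= rho) /\
    (i <> j -> x <> y)) ->
  (forall i x y, Q i x -> eucl_dist x y <= rho -> B y) ->
  (forall i, exists x, [/\ Q i x, X x & forall y, Q i y -> X y -> y = x]) ->
  (forall y, X y -> B y -> exists i, Q i y) ->
  let L := induced_subcomplex (VR X rho0) (X `&` \bigcup_i Q i) in
  isolated_subcomplex L (VR X rho0) /\ comb_equiv L (VR (range v) rho0).
Proof.
move=> vinj Qv QB QX BQ L; split.
  exists (X `&` \bigcup_i Q i); split=> //.
  move=> x y [_ [i _ Qx]] Xy Wy [_ _ _ xy]; apply: Wy; split=> //.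
  have [|j Qy] := BQ y Xy; last by exists j.
  by apply: (QB i x) => //; apply: xy; [left|right].
(* The cells are disjoint, so the image is well defined; outside them the value [x] is a dummy. *)
have /choice[f fP] (x : eucl R d) : exists z, forall i, Q i x -> z = v i.
  have [[i Qx]|nQ] := pselect (exists i, Q i x).
    exists (v i) => j Qx'; have [_ ij] := Qv i j x x Qx Qx'.
    by congr v; apply: contrapT => /ij.
  by exists x => i Qx; case: nQ; exists i.
have WQ x : vertices L x -> X x /\ exists i, Q i x.
  by move=> [Xx [_ [i _ Qx]]]; split=> //; exists i.
have finj : {in vertices L &, injective f}.
  move=> x y; rewrite !inE => /WQ[Xx [i Qx]] /WQ[Xy [j Qy]].
  rewrite (fP _ _ Qx) (fP _ _ Qy) => /vinj ij; rewrite -{j}ij in Qy.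
  by have [z [_ _ zP]] := QX i; rewrite (zP x)// (zP y).
exists f; first split=> //.
- by move=> x /WQ[Xx [i Qx]]; rewrite (fP _ _ Qx); exists i.
- move=> _ [i _ <-]; have [x [Qx Xx _]] := QX i; exists x; last exact: fP.
  by split=> //; split=> //; exists i.
move=> s sL.
have fdist x y : s x -> s y ->
    eucl_dist x y <= rho <-> eucl_dist (f x) (f y) <= rho.
  move=> /sL/WQ[_ [i Qx]] /sL/WQ[_ [j Qy]].
  by rewrite (fP _ _ Qx) (fP _ _ Qy); have [] := Qv i j x y Qx Qy.
split=> [[[fs [x sx] sX sd] _]|[ffs [_ [x sx _]] _ fd]].
- split; [exact: finite_image|by exists (f x), x| |].
  + by move=> _ [y /sL/WQ[_ [i Qy]] <-]; rewrite (fP _ _ Qy); exists i.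
  + by move=> _ _ [y sy <-] [z sz <-]; exact/(fdist y z sy sz).1/sd.
- split; last by move=> y /sL[].
  split; [|by exists x|by move=> y /sL[]|].
  + have finjs : {in s &, injective f}.
      by move=> y z; rewrite !inE => /sL yL /sL zL; apply: finj; rewrite inE.
    by rewrite -(eq_finite_set (inj_card_eq finjs)).
  + move=> y z sy sz; apply: (fdist y z sy sz).2.
    by apply: fd; [exists y|exists z].
Qed.

(** * Poisson probabilities and selection of indices *)

Lemma poisson_prob_set1 (R : realType) (r : R) (k n : nat) : 0 < r ->
  poisson_prob r n [set k] = (r ^+ k / k`!%:R * expR (- r))%:E.
Proof.
move=> r0; rewrite /poisson_prob r0 esum_set1 /poisson_pmf r0//.
by rewrite lee_fin mulr_ge0 ?expR_ge0// divr_ge0// exprn_ge0// ltW.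
Qed.

(** Rate 0 is included, so that void probabilities apply to null sets as well. *)
Lemma poisson_prob_set0 (R : realType) (r : R) (n : nat) : 0 <= r ->
  poisson_prob r n [set 0%N] = (expR (- r))%:E.
Proof.
rewrite le_eqVlt => /orP[/eqP <-|r0].
  by rewrite /poisson_prob ltxx diracE mem_set// oppr0 expR0.
by rewrite poisson_prob_set1// expr0 fact0 divr1 mul1r.
Qed.

Lemma increasing_selection (S : nat -> Prop) :
  (forall N, exists2 n, (N <= n)%N & S n) ->
  exists g : nat -> nat, injective g /\ forall k, S (g k).
Proof.
move=> hS; have /choice[h hP] N : exists n, (N <= n)%N /\ S n.
  by have [n] := hS N; exists n.
pose g := fix g k := if k is k'.+1 then h (g k').+1 else h 0%N.
exists g; split; last by case=> [|k]; exact: (hP _).2.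
have gS : {homo g : m n / (m < n)%N}.
  by apply: homo_ltn => [? ? ?|k]; [exact: ltn_trans|exact: (hP _).1].
exact/incn_inj/leq_mono.
Qed.

(** * Patterns of the Poisson process in disjoint boxes *)

Section poisson_grid.
Context (R : realType) (disp : measure_display) (Omega : measurableType disp).
Context (P : probability Omega R) (d : nat) (t : R).
Context (eta : R.-ker Omega ~> eucl R d).
Hypothesis heta : stationary_poisson_process P t eta.
Hypothesis t0 : 0 < t.

Lemma poisson_cube1 (c : 'I_d -> R) (e : R) : 0 < e ->
  P [set w | eta w (cube c e) = 1%E] =
  (t * (e *+ 2) ^+ d * expR (- (t * (e *+ 2) ^+ d)))%:E.
Proof.
move=> e0; have [_ pois _ _] := heta.
have := pois _ (measurable_cube c e); rewrite lebesgue_eucl_cube// -EFinM.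
move=> /(_ (ltry _) 1%N) ->.
rewrite poisson_prob_set1 ?fact1 ?divr1 ?expr1//.
by rewrite mulr_gt0// exprn_gt0// mulrn_wgt0.
Qed.

(** The void probability decreases with the measure of [B], which is at most that of the cube. The
    bound does not depend on the centre [c], hence is the same for all boxes. *)
Lemma poisson_void_ge (c : 'I_d -> R) (M : R) (B : set (eucl R d)) : 0 < M ->
  measurable B -> B `<=` cube c M ->
  ((expR (- (t * (M *+ 2) ^+ d)))%:E <= P [set w | eta w B = 0%E])%E.
Proof.
move=> M0 mB BM; have [_ pois _ _] := heta.
have lB : (lebesgue_eucl R d B <= ((M *+ 2) ^+ d)%:E)%E.
  rewrite -(lebesgue_eucl_cube c)//; apply: le_measure; rewrite ?inE//.
  exact: measurable_cube.
have fB : lebesgue_eucl R d B \is a fin_num.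
  by rewrite ge0_fin_numE// (le_lt_trans lB)// ltry.
have := pois _ mB; rewrite -(fineK fB) -EFinM => /(_ (ltry _) 0%N) ->.
have l0 : 0 <= fine (lebesgue_eucl R d B) by exact: fine_ge0.
rewrite poisson_prob_set0/=; last by rewrite mulr_ge0// ltW.
rewrite lee_fin ler_expR lerN2 ler_wpM2l ?(ltW t0)//.
by rewrite -lee_fin fineK.
Qed.

Lemma poisson_support_cube (w : Omega) (C : set (eucl R d)) :
  measurable C -> eta w C = 1%E ->
  exists x, [/\ C x, support_points (eta w) x &
    forall y, C y -> support_points (eta w) y -> y = x].
Proof.
have [pp _ _ _] := heta; move=> mC C1.
apply: (@unit_atom_point _ _ _ _ (@rational_halfspace R d)) => //.
- exact: measurable_rational_halfspace.
- exact: measurable_eucl1.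
- exact: rational_halfspace_separates.
- by move=> B mB B0; exact: point_process_ge1.
Qed.

Context (I : finType) (Q : nat -> I -> 'I_d -> R) (e M : R) (c : nat -> 'I_d -> R).
Hypotheses (e0 : 0 < e) (M0 : 0 < M).
Hypothesis QB : forall n i, cube (Q n i) e `<=` cube (c n) M.
Hypothesis Qdisj : forall n i j x, cube (Q n i) e x -> cube (Q n j) e x -> i = j.
Hypothesis Bdisj : forall m n x, cube (c m) M x -> cube (c n) M x -> m = n.

(** The key [(n, Some i)] stands for the [i]-th small cube in box [n], and [(n, None)] for the rest
    of that box; thus a single disjoint family carries all the counts. *)
Let cell (k : nat * option I) : set (eucl R d) :=
  if k.2 is Some i then cube (Q k.1 i) e
  else cube (c k.1) M `\` \bigcup_i cube (Q k.1 i) e.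

(** The boolean is read as a number: 1 for a small cube, 0 for the rest of a box. *)
Let count (k : nat * option I) : nat := k.2 != None.

Let cell_sub k : cell k `<=` cube (c k.1) M.
Proof. by case: k => n [i|] x; [exact: QB|case]. Qed.

Let measurable_cell k : measurable (cell k).
Proof.
case: k => n [i|]; first exact: measurable_cube.
apply: measurableD; first exact: measurable_cube.
by apply: fin_bigcup_measurable => // i _; exact: measurable_cube.
Qed.

Let trivIset_cell : trivIset [set: nat * option I] cell.
Proof.
move=> -[m o] [n o'] _ _ [x [xm xn]].
have mn := Bdisj (cell_sub xm) (cell_sub xn).
rewrite /= in mn; rewrite -{}mn in xn *; congr pair.
case: o o' xm xn => [i|] [j|] //=; rewrite /cell/=.
- by move=> xi xj; rewrite (Qdisj xi xj).
- by move=> xi [_ []]; exists i.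
- by move=> [_ +] xj; case; exists j.
Qed.

Lemma infinitely_many_patterns : {ae P, forall w N, exists2 n, (N <= n)%N &
  (forall i, eta w (cube (Q n i) e) = 1%E) /\
  eta w (cube (c n) M `\` \bigcup_i cube (Q n i) e) = 0%E}.
Proof.
pose E k := [set w | eta w (cell k) = (count k)%:R%:E].
have mE k : measurable (E k).
  rewrite -[X in measurable X]setTI.
  exact: (measurable_kernel eta _ (measurable_cell k) measurableT _
    (emeasurable_set1 _)).
pose A n := \big[setI/setT]_(o : option I) E (n, o).
pose p n := \prod_(o : option I) fine (P (E (n, o))).
have mA n : measurable (A n) by apply: measurable_bigsetI => o; exact: mE.
have indepA s : uniq s ->
    P (\big[setI/setT]_(i <- s) A i) = (\prod_(i <- s) p i)%:E.
  move=> us; rewrite /A -big_allpairs.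
  (* The intersection of the events [A i] is flattened into one over distinct pairs, to which
     independence of the counts applies. *)
  have us' : uniq [seq (n, o) | n <- s, o <- index_enum (option I)].
    by apply: allpairs_uniq => //; [exact: index_enum_uniq|move=> [? ?] [? ?]].
  rewrite [LHS](poisson_counts_independent count heta measurable_cell
    trivIset_cell us') big_allpairs -prodEFin.
  apply: eq_bigr => n _; rewrite -prodEFin; apply: eq_bigr => o _.
  by rewrite fineK// fin_num_measure.
(* Lower bounds for the probabilities of the cell events, uniform in [n]; their product is the
   constant for Borel-Cantelli. *)
pose q (o : option I) := if o is Some _
  then t * (e *+ 2) ^+ d * expR (- (t * (e *+ 2) ^+ d))
  else expR (- (t * (M *+ 2) ^+ d)).
have q0 o : 0 < q o.
  case: o => [i|] /=; last exact: expR_gt0.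
  by rewrite !mulr_gt0 ?expR_gt0// exprn_gt0// mulrn_wgt0.
have qp n : \prod_(o : option I) q o <= p n.
  apply: ler_prod => o _; rewrite ltW//=.
  rewrite -lee_fin fineK ?fin_num_measure//; case: o => [i|].
    by rewrite [leRHS](poisson_cube1 _ e0).
  exact: (poisson_void_ge M0 (measurable_cell (n, None)) (@cell_sub (n, None))).
have pq0 : 0 < \prod_(o : option I) q o by apply: prodr_gt0 => o _; exact: q0.
have := second_borel_cantelli mA indepA pq0 qp.
apply: filterS => w h N; have [n Nn] := h N; rewrite /A -bigcap_seq => wA.
exists n => //; split=> [i|].
  by apply: (wA (Some i)); rewrite /= mem_index_enum.
by apply: (wA None); rewrite /= mem_index_enum.
Qed.

End poisson_grid.

(** * Placement of the boxes and conclusion *)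

Unset Implicit Arguments.

Theorem theorem4p3 (R : realType) (disp : measure_display)
    (Omega : measurableType disp) (P : probability Omega R)
    (d : nat) (hd : (1 <= d)%N) (rho : R) (hrho : 0 < rho)
    (V : set (eucl R d)) (hVfin : finite_set V) (hV0 : V !=set0)
    (K : simplicial_complex (eucl R d)) (hK : K = VR V (ltW hrho))
    (t : R) (ht : 0 < t) (eta : R.-ker Omega ~> eucl R d)
    (heta : stationary_poisson_process P t eta) :
  {ae P, forall w, exists Kn : nat -> simplicial_complex (eucl R d),
    injective Kn /\
    forall n,
      isolated_subcomplex (Kn n) (VR (support_points (eta w)) (ltW hrho)) /\
      comb_equiv (Kn n) K}.
Proof.
have /finite_seqP[s0 Vs] := hVfin.
(* Removing duplicates makes the enumeration [v] of [V] injective. *)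
pose s := undup s0; pose v := tnth (in_tuple s).
have vinj : injective v by apply/tuple_uniqP; exact: undup_uniq.
have rangev : range v = V.
  apply/seteqP; split => [_ [j _ <-]|x].
    by rewrite Vs /= -mem_undup; exact: (mem_tnth j (in_tuple s)).
  rewrite Vs /= -mem_undup -/s => /(@tnthP _ _ (in_tuple s))[j ->].
  by exists j.
have [_ [j0 _ _]] : range v !=set0 by rewrite rangev.
have [l /andP[l0 l1] [e /andP[e0 e1] stable]] := stable_representation vinj hrho.
pose S := \sum_j \sum_k `|tnth (v j) k|.
have vS j k : `|tnth (v j) k| <= S.
  rewrite /S (bigD1 j)//= (bigD1 k)//= -addrA lerDl.
  by apply: addr_ge0; do ?[apply: sumr_ge0 => *].
have S0 : 0 <= S by do 2![apply: sumr_ge0 => ? _].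
(* A point within [rho] of a cube of copy [n] differs from [c n] in each coordinate by at most
   [rho], plus [e] for the cube, plus [S] for its centre. The spacing [M *+ 2 + 1] leaves a gap of 1
   between consecutive boxes. *)
pose M := rho + e + S; pose c (n : nat) := n%:R * (M *+ 2 + 1).
have M0 : 0 < M by rewrite /M; lra.
pose Q n j k := l * tnth (v j) k + c n.
have QB n j x y : cube (Q n j) e x -> eucl_dist x y <= rho ->
    cube (fun=> c n) M y.
  move=> /cubeP Qx xy; apply/cubeP => k.
  rewrite (_ : _ - _ = - (tnth x k - tnth y k) + (tnth x k - Q n j k) +
    l * tnth (v j) k); last by rewrite /Q; ring.
  rewrite (le_trans (ler_normD _ _))// lerD//; last first.
    by rewrite normrM ger0_norm// (le_trans _ (vS j k))// ler_piMl.
  rewrite (le_trans (ler_normD _ _))// lerD// normrN.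
  exact: le_trans (coord_dist_le _ _ _) xy.
have QB0 n j : cube (Q n j) e `<=` cube (fun=> c n) M.
  by move=> x /QB; apply; rewrite eucl_distxx ltW.
have Qdisj n i j x : cube (Q n i) e x -> cube (Q n j) e x -> i = j.
  move=> Qi Qj; have [_ ij] := stable _ _ _ _ _ Qi Qj.
  by apply: contrapT => /ij.
have Bsep m n (x : eucl R d) : (m < n)%N -> cube (fun=> c m) M x ->
    ~ cube (fun=> c n) M x.
  (* The boxes are placed along the diagonal, so the first coordinate, which exists as [d] is at
     least 1, separates them. *)
  move=> mn /cubeP/(_ (Ordinal hd)) + /cubeP/(_ (Ordinal hd)).
  rewrite !ler_distl => /andP[_ h1] /andP[h2 _].
  have : c m + (M *+ 2 + 1) <= c n.
    rewrite (_ : c m + _ = m.+1%:R * (M *+ 2 + 1)); last first.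
      by rewrite /c -natr1; ring.
    by rewrite ler_pM2r ?ler_nat//; lra.
  by rewrite mulr2n; lra.
have Bdisj m n (x : eucl R d) : cube (fun=> c m) M x ->
    cube (fun=> c n) M x -> m = n.
  by move=> Bm Bn; case: (ltngtP m n) => // /Bsep; [move=> /(_ _ Bm)|move=> /(_ _ Bn)].
have := infinitely_many_patterns heta ht e0 M0 QB0 Qdisj Bdisj.
apply: filterS => w patterns.
have [g [ginj gP]] := increasing_selection patterns.
pose X := support_points (eta w).
have one n j : exists x, [/\ cube (Q (g n) j) e x, X x &
    forall y, cube (Q (g n) j) e y -> X y -> y = x].
  have [/(_ j) Q1 _] := gP n.
  exact: (poisson_support_cube heta (measurable_cube _ _) Q1).
have none n y : X y -> cube (fun=> c (g n)) M y ->
    exists j, cube (Q (g n) j) e y.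
  move=> Xy By; apply: contrapT => nQ; have [_ B0] := gP n.
  have mB : measurable (cube (fun=> c (g n)) M `\`
      \bigcup_j cube (Q (g n) j) e).
    apply: measurableD; first exact: measurable_cube.
    by apply: fin_bigcup_measurable => // j _; exact: measurable_cube.
  (* Otherwise [y] would be an atom in the part of the box that has measure 0. *)
  have : (eta w [set y] <= 0)%E.
    rewrite -B0; apply: le_measure; rewrite ?inE//; first exact: measurable_eucl1.
    by move=> _ ->; split=> // -[j _ Qy]; apply: nQ; exists j.
  by rewrite leNgt; move/negP; apply.
exists (fun n => induced_subcomplex (VR X (ltW hrho))
  (X `&` \bigcup_j cube (Q (g n) j) e)); split; last first.
  move=> n; rewrite hK -rangev.
  apply: (isolated_VR_copy _ vinj _ _ (one n) (none n)).
  - by move=> i j x y Qi Qj; exact: (stable (c (g n))).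
  - by move=> i x y; exact: QB.
(* Equal subcomplexes share the point in the cube of [j0], so their boxes meet and coincide. *)
move=> m n mn; apply: ginj; have [x [Qx Xx _]] := one m j0.
have : vertices (induced_subcomplex (VR X (ltW hrho))
  (X `&` \bigcup_j cube (Q (g m) j) e)) x by split=> //; split=> //; exists j0.
rewrite mn => -[_ [_ [j _ Qx']]].
exact: (Bdisj _ _ x (QB0 _ _ _ Qx) (QB0 _ _ _ Qx')).
Qed.
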